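(* Let $\mathfrak{M}_0=(V_0,(\cdot,\cdot),A_0)$ be a Riemannian Einstein model with Einstein constant $s$, let $\{e_i\}$ be an orthonormal basis for $V_0$, and let $V_1=V_0^+\oplus V_0^-$ be the direct sum of two copies of $V_0$, with basis $\{e_i^+,e_i^-\}$. Let $\mathfrak{M}_1=(V_1,\langle\cdot,\cdot\rangle,A_1)$, where the non-zero components of $\langle\cdot,\cdot\rangle$ are $$\langle e_i^+,e_i^+\rangle=1,\qquad \langle e_i^-,e_i^-\rangle=-1,$$ and where $A_1$ is the $4$-tensor on $V_1$ with $$A_1(e_i^-,e_j^+,e_k^+,e_l^+)=A_1(e_i^+,e_j^-,e_k^+,e_l^+)=A_1(e_i^+,e_j^+,e_k^-,e_l^+)=A_1(e_i^+,e_j^+,e_k^+,e_l^-)=A_0(e_i,e_j,e_k,e_l),$$ $$A_1(e_i^+,e_j^-,e_k^-,e_l^-)=A_1(e_i^-,e_j^+,e_k^-,e_l^-)=A_1(e_i^-,e_j^-,e_k^+,e_l^-)=A_1(e_i^-,e_j^-,e_k^-,e_l^+)=-A_0(e_i,e_j,e_k,e_l),$$ all components of $A_1$ with an even number of superscripts $-$ being zero. Then $\mathfrak{M}_1$ is a neutral signature model with $\rho_{\mathfrak{M}_1}^2=-4s^2\operatorname{id}$, and $\mathfrak{M}_1$ is Jacobi--Videv.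
   Context: A model $\mathfrak{M}=(V,\langle\cdot,\cdot\rangle,A)$ consists of a finite-dimensional real vector space $V$, a non-degenerate inner product $\langle\cdot,\cdot\rangle$ of signature $(p,q)$ on $V$, and $A\in\otimes^4V^*$ with the symmetries of the Riemann curvature tensor: $A(v_1,v_2,v_3,v_4)=A(v_3,v_4,v_1,v_2)=-A(v_2,v_1,v_3,v_4)$ and $A(v_1,v_2,v_3,v_4)+A(v_2,v_3,v_1,v_4)+A(v_3,v_1,v_2,v_4)=0$. It is Riemannian if the inner product is positive definite, and of neutral signature if $p=q$. The curvature operator $\mathcal{A}$ and bilinear Jacobi operator $\mathcal{J}$ are characterized by $\langle\mathcal{A}(v_1,v_2)v_3,v_4\rangle=A(v_1,v_2,v_3,v_4)$ and $\langle\mathcal{J}(v_1,v_2)v_3,v_4\rangle=\frac12\{A(v_3,v_1,v_2,v_4)+A(v_3,v_2,v_1,v_4)\}$, and $\mathcal{J}(v):=\mathcal{J}(v,v)$. The Ricci form is $\rho(v_1,v_2)=\operatorname{Tr}\{\mathcal{J}(v_1,v_2)\}$, and the Ricci operator $\rho=\rho_{\mathfrak{M}}$ is the endomorphism of $V$ with $\langle\rho v_1,v_2\rangle=\rho(v_1,v_2)$. The model is Einstein with Einstein constant $s$ if $\rho=s\operatorname{id}$. It is Jacobi--Videv if $\mathcal{J}(v)\rho=\rho\mathcal{J}(v)$ for all $v\in V$. *)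

(* Defs.v *)
From HB Require Import structures.
From mathcomp Require Import all_boot all_order all_algebra.
From mathcomp Require Import boolp classical_sets reals.

Set Implicit Arguments.
Unset Strict Implicit.
Unset Printing Implicit Defensive.

Import GRing.Theory Num.Theory.
Local Open Scope ring_scope.

Section Models.
Variables (R : realType) (V : vectType R).
Implicit Types (g : {biscalar V}) (A : V -> V -> V -> V -> R).

Definition symmetric_form g := forall u v, g u v = g v u.

Definition nondegenerate_form g := forall u, (forall v, g u v = 0) -> u = 0.

Definition positive_definite g := forall u, u != 0 -> 0 < g u u.

(* Signature (p, q): p timelike (negative) and q spacelike (positive)
   directions, following the convention of pseudo-Riemannian geometry. *)
Definition has_signature g (p q : nat) :=
  exists2 b : (p + q).-tuple V, basis_of fullv b &
    forall i j : 'I_(p + q),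
      g b`_i b`_j = if i == j then (if (i < p)%N then -1 else 1) else 0.

Definition neutral_signature g := exists p, has_signature g p p.

Definition multilinear4 A :=
  [/\ forall y z w, scalar (fun x => A x y z w),
      forall x z w, scalar (fun y => A x y z w),
      forall x y w, scalar (fun z => A x y z w)
    & forall x y z, scalar (fun w => A x y z w)].

Definition curvature_tensor A :=
  [/\ multilinear4 A,
      forall x y z w, A x y z w = A z w x y,
      forall x y z w, A x y z w = - A y x z w
    & forall x y z w, A x y z w + A y z x w + A z x y w = 0].

Definition is_model g A :=
  [/\ symmetric_form g, nondegenerate_form g & curvature_tensor A].

Definition riemannian_model g A := is_model g A /\ positive_definite g.

(* The endomorphism T of V characterized by g (T x) y = b x y; it exists and is
   unique for bilinear b and nondegenerate g, see assoc_endP and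
   assoc_end_unique (the default 0 is then never used). *)
Definition assoc_end g (b : V -> V -> R) : 'End(V) :=
  xget 0 [set T : 'End(V) | forall x y, g (T x) y = b x y]%classic.

Lemma assoc_end_unique g (b : V -> V -> R) (T T' : 'End(V)) :
  nondegenerate_form g ->
  (forall x y, g (T x) y = b x y) -> (forall x y, g (T' x) y = b x y) ->
  T = T'.
Proof.
move=> nd hT hT'; apply/lfunP => x; apply/eqP; rewrite -subr_eq0; apply/eqP.
by apply: nd => y; rewrite linearBl hT hT' subrr.
Qed.

Lemma assoc_endP g (b : V -> V -> R) :
  nondegenerate_form g ->
  (forall y, scalar (b^~ y)) -> (forall x, scalar (b x)) ->
  forall x y, g (assoc_end g b x) y = b x y.
Proof.
move=> nd bl br; pose e := vbasis {:V}.
pose row (f : V -> R) : 'rV[R]_(\dim {:V}) := \row_i f e`_i.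
have ext (f : V -> R) : scalar f -> forall v, f v = \sum_i coord e i v * f e`_i.
  move=> lf v; pose F : {scalar V} := HB.pack f (GRing.isLinear.Build _ _ _ _ f lf).
  rewrite -[f]/(F : V -> R) {1}(coord_vbasis (memvf v)) linear_sum.
  by apply: eq_bigr => i _; rewrite linearZ.
have rowE (f f' : V -> R) : scalar f -> scalar f' -> row f = row f' -> f =1 f'.
  move=> lf lf' /rowP eq_ff' v; rewrite (ext _ lf) (ext _ lf').
  by apply: eq_bigr => i _; have := eq_ff' i; rewrite !mxE => ->.
have gl u : scalar (g u) by move=> a v w; rewrite linearPr.
have flat_lin : linear (row \o g).
  by move=> a u v; apply/rowP => i; rewrite !mxE linearPl.
pose flat : 'Hom(V, 'rV[R]_(\dim {:V})) :=
  linfun (HB.pack (row \o g) (GRing.isLinear.Build _ _ _ _ _ flat_lin)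
          : {linear V -> 'rV[R]_(\dim {:V})}).
have flatE u : flat u = row (g u) by rewrite lfunE.
have ker0 : lker flat == 0%VS.
  rewrite -subv0; apply/subvP => u; rewrite memv_ker memv0 flatE => /eqP u0.
  apply/eqP/nd => v; rewrite (ext _ (gl u)) big1 // => i _.
  by move/rowP/(_ i): u0; rewrite !mxE => ->; rewrite mulr0.
have full : limg flat = fullv.
  apply/eqP; rewrite eqEdim subvf /= limg_dim_eq; last first.
    by rewrite (eqP ker0) capv0.
  by rewrite dimvf /dim /= mul1n.
have T_lin : linear (fun x => (flat^-1)%VF (row (b x))).
  move=> a x y; rewrite -linearP; congr (_ _).
  by apply/rowP => i; rewrite !mxE bl.
pose T : 'End(V) :=
  linfun (HB.pack (fun x => (flat^-1)%VF (row (b x)))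
            (GRing.isLinear.Build _ _ _ _ _ T_lin) : {linear V -> V}).
have TE x y : g (T x) y = b x y.
  apply: rowE => //; rewrite -flatE [T x]lfunE /=.
  by apply: (limg_lfunVK (f := flat)); rewrite full memvf.
exact: (@xgetPex _ 0 [set T : 'End(V) | forall x y, g (T x) y = b x y]%classic
          (ex_intro _ T TE)).
Qed.

Definition jacobi_op g A (v1 v2 : V) : 'End(V) :=
  assoc_end g (fun v3 v4 => 2^-1 * (A v3 v1 v2 v4 + A v3 v2 v1 v4)).

Definition trace_end (f : 'End(V)) : R :=
  \tr (passmx.mxof (vbasis fullv) (vbasis fullv) f).

Definition ricci_form g A (v1 v2 : V) : R := trace_end (jacobi_op g A v1 v2).

Definition ricci_op g A : 'End(V) := assoc_end g (ricci_form g A).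

Definition einstein g A (s : R) := ricci_op g A = s *: \1%VF.

Definition jacobi_videv g A :=
  forall v, (jacobi_op g A v v \o ricci_op g A =
             ricci_op g A \o jacobi_op g A v v)%VF.

Definition orthonormal_basis g n (e : n.-tuple V) :=
  basis_of fullv e /\ forall i j : 'I_n, g e`_i e`_j = (i == j)%:R.

End Models.

Section Double.
Variables (R : realType) (V : vectType R).

(* The direct sum of two copies of V is V * V; v^+ = (v, 0), v^- = (0, v). *)
Definition double_space : vectType R := (V * V)%type.
Definition pos_copy (v : V) : double_space := (v, 0).
Definition neg_copy (v : V) : double_space := (0, v).
Definition copy (minus : bool) : V -> double_space :=
  if minus then neg_copy else pos_copy.

Definition double_form_components n (e : n.-tuple V)
    (g1 : {biscalar double_space}) :=
  [/\ forall i : 'I_n, g1 (pos_copy e`_i) (pos_copy e`_i) = 1,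
      forall i : 'I_n, g1 (neg_copy e`_i) (neg_copy e`_i) = -1
    & forall (a b : bool) (i j : 'I_n), (a, i) != (b, j) ->
        g1 (copy a e`_i) (copy b e`_j) = 0].

Definition double_tensor_components n (e : n.-tuple V)
    (A0 : V -> V -> V -> V -> R)
    (A1 : double_space -> double_space -> double_space -> double_space -> R) :=
  let p (i : 'I_n) := pos_copy e`_i in
  let m (i : 'I_n) := neg_copy e`_i in
  forall i j k l : 'I_n,
  let a0 := A0 e`_i e`_j e`_k e`_l in
  [/\ [/\ A1 (m i) (p j) (p k) (p l) = a0,
          A1 (p i) (m j) (p k) (p l) = a0,
          A1 (p i) (p j) (m k) (p l) = a0
        & A1 (p i) (p j) (p k) (m l) = a0],
      [/\ A1 (p i) (m j) (m k) (m l) = - a0,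
          A1 (m i) (p j) (m k) (m l) = - a0,
          A1 (m i) (m j) (p k) (m l) = - a0
        & A1 (m i) (m j) (m k) (p l) = - a0]
    & forall a b c d : bool, ~~ odd (a + b + c + d)%N ->
        A1 (copy a e`_i) (copy b e`_j) (copy c e`_k) (copy d e`_l) = 0].

End Double.

(* Main.v *)
Require Import Defs.
From HB Require Import structures.
From mathcomp Require Import all_boot all_order all_algebra.
From mathcomp Require Import reals.
From mathcomp Require Import ring lra.

Set Implicit Arguments.
Unset Strict Implicit.
Unset Printing Implicit Defensive.

Import GRing.Theory Num.Theory.
Local Open Scope ring_scope.

(** Read [(u, v)] in the doubled space as the complex vector [u + i v], where
    [i = sqrt (-1)]. Expanding on the basis, a component with [k] minus signs of
    the complex multilinear extension of a real tensor carries the factor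
    [i ^ k]. Comparing signs with the prescribed components shows that [g1] is
    the real part of the complexified inner product ([double_formE]) and that
    [A1] is the imaginary part of the complexified curvature tensor
    ([double_tensorE]). All the claims then follow from the complexification.

    The curvature symmetries are linear identities, so they pass to the
    complexification and to its imaginary part ([im_tensor_curvature]). The form
    [g1] is [g0] minus [g0], hence nondegenerate of neutral signature.

    Since [Im z = Re (- i z)], the Jacobi operator of [A1] is [- i] times the
    complexified Jacobi operator ([double_jacobi]). In particular it is complex
    linear. As a real block matrix it has both diagonal blocks equal to its real
    part, so its real trace is twice the trace of that part. If [A0] is Einstein
    with constant [s], the complexified Ricci operator is [s], so the Ricci
    operator of [A1] is multiplication by [- 2 i s] ([double_ricci_op]). Its
    square is [- 4 s ^ 2], and it commutes with every complex linear operator,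
    in particular with the Jacobi operators. *)

(** * Scalar functions and traces *)

Section Trace.
Variable R : realType.

Lemma scalarD (U : lmodType R) (f : U -> R) u v :
  scalar f -> f (u + v) = f u + f v.
Proof. by move=> lf; have := lf 1 u v; rewrite !scale1r mul1r. Qed.

Lemma scalar0 (U : lmodType R) (f : U -> R) : scalar f -> f 0 = 0.
Proof.
move=> lf; have /eqP := scalarD 0 0 lf.
by rewrite addr0 eq_sym -subr_eq0 addrK => /eqP.
Qed.

Lemma scalarZ (U : lmodType R) (f : U -> R) a u :
  scalar f -> f (a *: u) = a * f u.
Proof. by move=> lf; have := lf a u 0; rewrite !addr0 (scalar0 lf) addr0. Qed.

Lemma trace_end_is_scalar (V : vectType R) : scalar (@trace_end R V).
Proof.
by move=> a f h; rewrite /trace_end passmx.mxof_linear mxtraceD mxtraceZ.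
Qed.

Lemma trace_endD (V : vectType R) (f h : 'End(V)) :
  trace_end (f + h) = trace_end f + trace_end h.
Proof. exact: scalarD (@trace_end_is_scalar V). Qed.

(** Cyclicity across two different spaces gives block-wise computations of
    traces without choosing bases adapted to the blocks. *)
Lemma trace_end_comp (V W : vectType R) (f : 'Hom(W, V)) (h : 'Hom(V, W)) :
  trace_end (f \o h)%VF = trace_end (h \o f)%VF.
Proof.
rewrite /trace_end (passmx.mxof_comp _ _ (vbasisP {:W})).
by rewrite (passmx.mxof_comp _ _ (vbasisP {:V})) mxtrace_mulC.
Qed.

End Trace.

(** * Jacobi and Ricci operators of a model *)

Section Models.
Variables (R : realType) (V : vectType R).
Implicit Types (g : {biscalar V}) (A : V -> V -> V -> V -> R).

Lemma nondegenerate_inj g u v :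
  nondegenerate_form g -> (forall y, g u y = g v y) -> u = v.
Proof.
move=> nd guv; apply/eqP; rewrite -subr_eq0; apply/eqP/nd => y.
by rewrite linearBl guv subrr.
Qed.

Lemma scalar_basisE n (e : n.-tuple V) (f : V -> R) :
  basis_of fullv e -> scalar f ->
  forall v, f v = \sum_i coord e i v * f e`_i.
Proof.
move=> be lf v; rewrite {1}(coord_basis be (memvf v)).
elim/big_ind2: _ => [|x a y b <- <-|i _]; first exact: scalar0.
  exact: scalarD.
exact: scalarZ.
Qed.

Lemma jacobi_opE g A : nondegenerate_form g -> multilinear4 A ->
  forall v1 v2 x y, g (jacobi_op g A v1 v2 x) y =
    2^-1 * (A x v1 v2 y + A x v2 v1 y).
Proof.
move=> nd [A1 _ _ A4] v1 v2 x y; rewrite /jacobi_op assoc_endP //.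
  by move=> z a u v /=; rewrite !A1; ring.
by move=> z a u v /=; rewrite !A4; ring.
Qed.

Lemma jacobi_opC g A : nondegenerate_form g -> multilinear4 A ->
  forall v w, jacobi_op g A v w = jacobi_op g A w v.
Proof.
move=> nd mA v w; apply/lfunP => x; apply: (nondegenerate_inj nd) => y.
by rewrite !jacobi_opE // [A x v w y + _]addrC.
Qed.

Lemma jacobi_op_linearl g A : nondegenerate_form g -> multilinear4 A ->
  forall a u v w, jacobi_op g A (a *: u + v) w =
    a *: jacobi_op g A u w + jacobi_op g A v w.
Proof.
move=> nd mA a u v w; apply/lfunP => x; apply: (nondegenerate_inj nd) => y.
rewrite add_lfunE scale_lfunE linearPl /= !jacobi_opE //.
by case: mA => _ A2 A3 _; rewrite A2 A3; ring.
Qed.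

(** The Ricci form is bilinear because a Jacobi operator depends linearly on its
    vectors and the trace is linear, so [assoc_end] applies to it. *)
Lemma ricci_opE g A : nondegenerate_form g -> multilinear4 A ->
  forall x y, g (ricci_op g A x) y = ricci_form g A x y.
Proof.
move=> nd mA; have lin w : scalar (ricci_form g A ^~ w).
  by move=> a u v; rewrite /ricci_form jacobi_op_linearl // trace_end_is_scalar.
apply: assoc_endP => // x a u v.
by rewrite /ricci_form ![jacobi_op g A x _]jacobi_opC //; apply: lin.
Qed.

Lemma einstein_ricci_form g A s : nondegenerate_form g -> multilinear4 A ->
  einstein g A s -> forall x y, ricci_form g A x y = s * g x y.
Proof.
move=> nd mA es x y; rewrite -ricci_opE // es scale_lfunE id_lfunE.
by rewrite linearZl.
Qed.

Lemma free_orthogonal g n (b : n.-tuple V) :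
  (forall i j : 'I_n, i != j -> g b`_i b`_j = 0) ->
  (forall i : 'I_n, g b`_i b`_i != 0) -> free b.
Proof.
move=> ortho nz; apply/freeP => k k0 i.
have : g (\sum_j k j *: b`_j) b`_i = 0 by rewrite k0 linear0l.
rewrite linear_sumlz (bigD1 i) //= big1 ?addr0; last first.
  by move=> j ji; rewrite linearZl_LR /= ortho ?mulr0.
by rewrite linearZl_LR => /eqP; rewrite mulf_eq0 (negPf (nz i)) orbF => /eqP.
Qed.

End Models.

(** * Complexification on the doubled space *)

Section Double.
Variables (R : realType) (V : vectType R).
Local Notation W := (double_space V).
Implicit Types (g : {biscalar V}) (A : V -> V -> V -> V -> R).
Implicit Types x y z w : W.

Fact copy_is_linear b : linear (copy b : V -> W).
Proof.
by case: b => a u v; apply: injective_projections => //=; rewrite scaler0 addr0.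
Qed.

HB.instance Definition _ b :=
  GRing.isLinear.Build R V W *:%R (copy b) (copy_is_linear b).

Lemma copy_sum x : x = copy false x.1 + copy true x.2.
Proof.
by case: x => u v; apply: injective_projections; rewrite /= (addr0, add0r).
Qed.

(** Insert the identity of [V * V] as the sum of the two coordinate projectors,
    then move each projection around by cyclicity of the trace. *)
Lemma trace_end_double (f : 'End(W)) (P Q : 'End(V)) :
  (forall u, (f (u, 0)).1 = P u) -> (forall u, (f (0, u)).2 = Q u) ->
  trace_end f = trace_end P + trace_end Q.
Proof.
move=> fP fQ.
pose i1 : 'Hom(V, W) := linfun (copy false).
pose i2 : 'Hom(V, W) := linfun (copy true).
pose p1 : 'Hom(W, V) := linfun (fst : W -> V).
pose p2 : 'Hom(W, V) := linfun (snd : W -> V).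
have -> : f = (((f \o i1) \o p1) + ((f \o i2) \o p2))%VF.
  apply/lfunP => x; rewrite add_lfunE !comp_lfunE !lfunE /=.
  by rewrite -linearD -copy_sum.
rewrite trace_endD !(trace_end_comp (f \o _)%VF).
congr (_ + _); congr trace_end; apply/lfunP => u; rewrite !comp_lfunE !lfunE /=.
  exact: fP.
exact: fQ.
Qed.

Lemma double_scalar_ext n (e : n.-tuple V) (f h : W -> R) :
  basis_of fullv e -> scalar f -> scalar h ->
  (forall a (i : 'I_n), f (copy a e`_i) = h (copy a e`_i)) -> f =1 h.
Proof.
move=> be lf lh fh x; rewrite [x]copy_sum !scalarD //.
have lin k a : scalar k -> scalar (k \o copy a : V -> R).
  by move=> lk c u v; rewrite /= linearP lk.
have eqa a v : f (copy a v) = h (copy a v).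
  rewrite -[LHS]/((f \o copy a) v) -[RHS]/((h \o copy a) v).
  rewrite !(scalar_basisE be (lin _ _ _)) //.
  by apply: eq_bigr => i _ /=; rewrite fh.
by rewrite !eqa.
Qed.

(** Real part of the complex bilinear extension of [g]. *)
Definition re_form g x y := g x.1 y.1 - g x.2 y.2.

(** Imaginary part of the complex multilinear extension of [A]: a term with [k]
    imaginary arguments has the factor [i ^ k], which is [i] for [k = 1] and
    [- i] for [k = 3]. *)
Definition im_tensor A x y z w :=
  A x.2 y.1 z.1 w.1 + A x.1 y.2 z.1 w.1 + A x.1 y.1 z.2 w.1 + A x.1 y.1 z.1 w.2
  - (A x.1 y.2 z.2 w.2 + A x.2 y.1 z.2 w.2 + A x.2 y.2 z.1 w.2
     + A x.2 y.2 z.2 w.1).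

Lemma im_tensor_multilinear A : multilinear4 A -> multilinear4 (im_tensor A).
Proof.
move=> [A1 A2 A3 A4]; split=> x y z a u v; rewrite /im_tensor /=.
- by rewrite !A1; ring.
- by rewrite !A2; ring.
- by rewrite !A3; ring.
- by rewrite !A4; ring.
Qed.

Lemma im_tensor_curvature A :
  curvature_tensor A -> curvature_tensor (im_tensor A).
Proof.
case=> mA sA aA bA; split; first exact: im_tensor_multilinear.
- move=> [x x'] [y y'] [z z'] [w w']; rewrite /im_tensor /=.
  rewrite (sA x') (sA x y') (sA x y z') (sA x y z w') (sA x y' z') (sA x' y z').
  by rewrite (sA x' y' z) (sA x' y' z'); ring.
- move=> [x x'] [y y'] [z z'] [w w']; rewrite /im_tensor /=.
  rewrite (aA x') (aA x y') (aA x y z') (aA x y z w') (aA x y' z') (aA x' y z').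
  by rewrite (aA x' y' z) (aA x' y' z'); ring.
- move=> [x x'] [y y'] [z z'] [w w']; rewrite /im_tensor /=.
  move: (bA x' y z w) (bA x y' z w) (bA x y z' w) (bA x y z w').
  move: (bA x y' z' w') (bA x' y z' w') (bA x' y' z w') (bA x' y' z' w).
  lra.
Qed.

Lemma double_formE n (e : n.-tuple V) g (g1 : {biscalar W}) :
  orthonormal_basis g e -> double_form_components e g1 ->
  forall x y, g1 x y = re_form g x y.
Proof.
move=> [be on] [g1p g1m g1o] x y.
apply: (double_scalar_ext (f := g1 x) (h := re_form g x) be)
  => [a u v|a u v|b j].
- by rewrite linearPr.
- by rewrite /re_form /= !linearPr /=; ring.
apply: (double_scalar_ext (f := g1 ^~ _) (h := re_form g ^~ _) be)
  => [c u v|c u v|a i].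
- by rewrite linearPl.
- by rewrite /re_form /= !linearPl /=; ring.
have [[-> ->]|ne] := eqVneq (a, i) (b, j).
  rewrite /re_form; case: b => /=.
    by rewrite g1m on eqxx linear0l sub0r.
  by rewrite g1p on eqxx linear0l subr0.
rewrite g1o // /re_form; move: ne; rewrite xpair_eqE.
case: a b => [] [] //= ij;
  rewrite ?linear0l ?linear0r ?on ?(negPf ij) ?(subr0, sub0r, mulr0n, oppr0) //.
Qed.

Lemma double_tensorE n (e : n.-tuple V) A (A1 : W -> W -> W -> W -> R) :
  basis_of fullv e -> multilinear4 A -> multilinear4 A1 ->
  double_tensor_components e A A1 ->
  forall x y z w, A1 x y z w = im_tensor A x y z w.
Proof.
move=> be mA [l1 l2 l3 l4] A1e x y z w.
(* Both sides are multilinear, so basis vectors may replace the arguments, one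
   argument at a time. *)
have [m1 m2 m3 m4] := im_tensor_multilinear mA.
apply: (double_scalar_ext (f := A1 x y z) (h := im_tensor A x y z) be)
  => [||d l]; [exact: l4|exact: m4|].
apply: (double_scalar_ext (f := fun z => A1 x y z _)
                        (h := fun z => im_tensor A x y z _) be)
  => [||c k]; [exact: l3|exact: m3|].
apply: (double_scalar_ext (f := fun y => A1 x y _ _)
                        (h := fun y => im_tensor A x y _ _) be)
  => [||b j]; [exact: l2|exact: m2|].
apply: (double_scalar_ext (f := fun x => A1 x _ _ _)
                        (h := fun x => im_tensor A x _ _ _) be)
  => [||a i]; [exact: l1|exact: m1|].
have [[o1 o2 o3 o4] [t1 t2 t3 t4] ev] := A1e i j k l.
case: mA => a1 a2 a3 a4.
have A_zero : ((forall p q r, A 0 p q r = 0) * (forall p q r, A p 0 q r = 0))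
        * ((forall p q r, A p q 0 r = 0) * (forall p q r, A p q r 0 = 0)).
  split; split=> p q r.
  - exact: (scalar0 (a1 p q r)).
  - exact: (scalar0 (a2 p q r)).
  - exact: (scalar0 (a3 p q r)).
  - exact: (scalar0 (a4 p q r)).
case: (boolP (odd (a + b + c + d))) => [od|nod].
- case: a b c d od => [] [] [] [] //= _;
    by rewrite /im_tensor /= !A_zero ?(o1, o2, o3, o4, t1, t2, t3, t4); ring.
- rewrite ev //; case: a b c d nod => [] [] [] [] //= _;
    by rewrite /im_tensor /= !A_zero; ring.
Qed.

End Double.

(** * The doubled model *)

Section DoubleModel.
Variables (R : realType) (V : vectType R).
Local Notation W := (double_space V).
Variables (g : {biscalar V}) (A : V -> V -> V -> V -> R).
Variables (g1 : {biscalar W}) (A1 : W -> W -> W -> W -> R).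
Hypothesis g1E : forall x y, g1 x y = re_form g x y.
Hypothesis A1E : forall x y z w, A1 x y z w = im_tensor A x y z w.

Lemma double_symmetric : Defs.symmetric_form g -> Defs.symmetric_form g1.
Proof. by move=> sg x y; rewrite !g1E /re_form sg [g x.2 _]sg. Qed.

Lemma double_nondegenerate : nondegenerate_form g -> nondegenerate_form g1.
Proof.
move=> nd [u v] uv0; have [u0 v0] : u = 0 /\ v = 0.
  split; apply: nd => y.
    by have := uv0 (y, 0); rewrite g1E /re_form /= linear0r subr0.
  have /eqP := uv0 (0, y); rewrite g1E /re_form /= linear0r sub0r oppr_eq0.
  by move/eqP.
by rewrite u0 v0.
Qed.

Lemma double_signature n (e : n.-tuple V) :
  orthonormal_basis g e -> has_signature g1 n n.
Proof.
move=> [be on].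
(* The first n vectors of the basis have to be the negative ones. *)
pose b : (n + n).-tuple W := [tuple of map (copy true) e ++ map (copy false) e].
have bE (a : bool) (k : 'I_n) :
    b`_(if a then k : nat else n + k)%N = copy a e`_k.
  rewrite /b /= nth_cat size_map size_tuple; case: a.
    by rewrite ltn_ord (nth_map 0) ?size_tuple.
  by rewrite ltnNge leq_addr /= addKn (nth_map 0) ?size_tuple.
have bP (i : 'I_(n + n)) : exists a : bool, exists k : 'I_n,
    [/\ (i : nat) = (if a then k : nat else n + k)%N, (i < n)%N = a
      & b`_i = copy a e`_k].
  case: (split_ordP i) => k ->; [exists true | exists false]; exists k;
    split=> //=.
  - exact: (bE true k).
  - exact: (bE false k).
have gb (i j : 'I_(n + n)) :
    g1 b`_i b`_j = if i == j then (if (i < n)%N then -1 else 1) else 0.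
  have [a [k [ik ia ->]]] := bP i; have [c [l [jl jc ->]]] := bP j.
  rewrite g1E /re_form -val_eqE /= ia.
  case: a ik ia => ik ia; case: c jl jc => jl jc /=;
    rewrite ?linear0l ?linear0r ?on ik jl.
  - by rewrite -val_eqE /=; case: eqP => _; rewrite sub0r ?oppr0.
  - by rewrite (ltn_eqF (leq_trans (ltn_ord k) (leq_addr _ _))) subrr.
  - by rewrite eq_sym (ltn_eqF (leq_trans (ltn_ord l) (leq_addr _ _))) subrr.
  - by rewrite eqn_add2l -val_eqE /=; case: eqP => _; rewrite subr0.
exists b => //; rewrite basisEfree subvf (free_orthogonal (g := g1)) /=.
- have := size_basis be; rewrite dimvf => de.
  by rewrite dimvf size_tuple -[dim W]/(dim V + dim V)%N de.
- by move=> i j /negPf ij; rewrite gb ij.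
- by move=> i; rewrite gb eqxx; case: ifP; rewrite ?oppr_eq0 oner_eq0.
Qed.

Hypotheses (nd : nondegenerate_form g) (mA : multilinear4 A).
Hypothesis mA1 : multilinear4 A1.
Local Notation J := (jacobi_op g A).

(** With [x = a + i b] and [y = c + i d], the complexified Jacobi operator is
    [(J a c - J b d) + i (J a d + J b c) = Q + i P], and [- i] times it is
    [P - i Q]. *)
Lemma double_jacobi x y z :
  let P := J x.1 y.2 + J x.2 y.1 in
  let Q := J x.1 y.1 - J x.2 y.2 in
  jacobi_op g1 A1 x y z = (P z.1 + Q z.2, P z.2 - Q z.1).
Proof.
apply: (nondegenerate_inj (double_nondegenerate nd)) => w.
rewrite (jacobi_opE (double_nondegenerate nd) mA1) !A1E g1E.
rewrite /re_form /im_tensor /=.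
rewrite !(add_lfunE, opp_lfunE) !(linearDl, linearBl, linearNl) /=.
rewrite !jacobi_opE //; ring.
Qed.

(** Both diagonal blocks of [P - i Q] are [P], whence the factor 2. *)
Lemma double_ricci_form x y :
  ricci_form g1 A1 x y = 2 * (ricci_form g A x.1 y.2 + ricci_form g A x.2 y.1).
Proof.
rewrite /ricci_form (trace_end_double (P := J x.1 y.2 + J x.2 y.1)
                                      (Q := J x.1 y.2 + J x.2 y.1)).
- by rewrite trace_endD; ring.
- by move=> u; rewrite double_jacobi /= linear0 addr0.
- by move=> u; rewrite double_jacobi /= linear0 subr0.
Qed.

(** The pair on the right is [- 2 i s] times the complex vector [x]. *)
Lemma double_ricci_op s : einstein g A s ->
  forall x, ricci_op g1 A1 x = ((2 * s) *: x.2, - ((2 * s) *: x.1)).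
Proof.
move=> es x; apply: (nondegenerate_inj (double_nondegenerate nd)) => y.
rewrite (ricci_opE (double_nondegenerate nd) mA1) double_ricci_form.
rewrite !(einstein_ricci_form nd mA es) g1E /re_form /=.
by rewrite linearNl !linearZl_LR /=; ring.
Qed.

End DoubleModel.

Theorem theorem1p8 (R : realType) (V0 : vectType R)
    (g0 : {biscalar V0}) (A0 : V0 -> V0 -> V0 -> V0 -> R) (s : R)
    (n : nat) (e : n.-tuple V0)
    (g1 : {biscalar (double_space V0)})
    (A1 : double_space V0 -> double_space V0 -> double_space V0 ->
          double_space V0 -> R) :
  riemannian_model g0 A0 ->
  einstein g0 A0 s ->
  orthonormal_basis g0 e ->
  double_form_components e g1 ->
  multilinear4 A1 ->
  double_tensor_components e A0 A1 ->
  [/\ is_model g1 A1,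
      neutral_signature g1,
      (ricci_op g1 A1 \o ricci_op g1 A1)%VF = (- (4 * s ^+ 2)) *: \1%VF
    & jacobi_videv g1 A1].
Proof.
move=> [[sg nd cA] _] es on g1c mA1 A1c; have [mA _ _ _] := cA.
have g1E := double_formE on g1c.
have A1E := double_tensorE on.1 mA mA1 A1c.
have ric := double_ricci_op g1E A1E nd mA mA1 es.
split.
- split; [exact: double_symmetric g1E sg|exact: double_nondegenerate g1E nd|].
  have [_ s1 a1 b1] := im_tensor_curvature cA.
  by split=> // x y z w; rewrite !A1E.
- by exists n; exact: (double_signature g1E on).
- apply/lfunP => -[u v]; rewrite comp_lfunE !ric scale_lfunE id_lfunE /=.
  apply: injective_projections => /=; rewrite ?scalerN -?scaleNr !scalerA;
    congr (_ *: _); ring.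
- move=> v; apply/lfunP => -[u w]; rewrite !comp_lfunE ric.
  rewrite !(double_jacobi g1E A1E nd mA mA1) ric /=.
  apply: injective_projections => /=;
    rewrite !(linearN, linearZ) /=;
    by rewrite !(scalerDr, scalerBr, scalerN, opprD, opprK).
Qed.
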